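(* Let $p\in[1,\infty]$, $\alpha_p>0$ and $\epsilon\ge 0$. Let $\mathrm{m}:\mathcal X\to\mathcal P(\mathcal Y)$ be a randomized classifier that is $(\alpha_p,\epsilon)$-robust with respect to the total variation distance $D_{TV}$. Then $$\mathcal R^{adv}(\mathrm m;\alpha_p)\le \mathcal R(\mathrm m)+\epsilon .$$
   Context: $\mathcal X\subset[-1,1]^d$ is the input space, $\mathcal Y=\{1,\dots,K\}$ the label set, $\mathcal D$ a probability distribution on $\mathcal X\times\mathcal Y$. $\mathcal P(\mathcal Y)$ is the set of probability measures on $\mathcal Y$. A randomized classifier is a map $\mathrm m:\mathcal X\to\mathcal P(\mathcal Y)$. All functions are assumed measurable so that the expectations below make sense. Total variation distance: $D_{TV}(\rho,\rho')=\sup_{Z}|\rho(Z)-\rho'(Z)|$, supremum over measurable sets $Z$. For a metric/divergence $D$ on $\mathcal P(\mathcal Y)$, $\mathrm m$ is $(\alpha_p,\epsilon)$-robust w.r.t. $D$ if for all $x,x'\in\mathcal X$ with $\|x-x'\|_p\le\alpha_p$ one has $D(\mathrm m(x),\mathrm m(x'))\le\epsilon$. Loss: $\mathcal L_{0/1}(\mathrm m(x),y)=\mathbb E_{\hat y\sim \mathrm m(x)}[\mathbf 1\{\hat y\ne y\}]$. Risk: $\mathcal R(\mathrm m)=\mathbb E_{(x,y)\sim\mathcal D}[\mathcal L_{0/1}(\mathrm m(x),y)]$. Adversarial risk: $\mathcal R^{adv}(\mathrm m;\alpha_p)=\mathbb E_{(x,y)\sim\mathcal D}\big[\sup_{\tau}\mathcal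 L_{0/1}(\mathrm m(x+\tau),y)\big]$, where the supremum is over perturbations $\tau$ with $\|\tau\|_p\le\alpha_p$ and $x+\tau\in\mathcal X$ (so that $\mathrm m(x+\tau)$ is defined). *)

(* Defs.v *)
From HB Require Import structures.
From mathcomp Require Import all_boot all_order all_algebra.
From mathcomp Require Import all_classical all_reals all_analysis.
From mathcomp Require Import measurable_realfun.

Set Implicit Arguments.
Unset Strict Implicit.
Unset Printing Implicit Defensive.

Import Order.TTheory GRing.Theory Num.Theory.
Import numFieldNormedType.Exports.

Local Open Scope classical_set_scope.
Local Open Scope ring_scope.

(* The l_p norm on R^d for p in [1, +oo]; other values of p are irrelevant. *)
Definition lpnorm (R : realType) (d : nat) (p : \bar R) (v : 'rV[R]_d) : R :=
  match p with
  | r%:E => (\sum_(i < d) `|v 0 i| `^ r) `^ r^-1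
  | _ => \big[Num.max/0]_(i < d) `|v 0 i|
  end.

(* A measurableType is inhabited, hence the proof arguments X0 and K0 below;
   both hold as soon as there is a probability measure on X x Y. *)
Section input_space.
Context (R : realType) (d : nat) (X : set 'rV[R]_d) (X0 : X !=set0).

Definition input_point & X !=set0 : Type := set_type X.

HB.instance Definition _ := Choice.on (input_point X0).
HB.instance Definition _ := isPointed.Build (input_point X0)
  (exist _ (projT1 (cid X0)) (mem_set (projT2 (cid X0)))).

Definition input_val (x : input_point X0) :
  g_sigma_algebraType (@open 'rV[R]_d) := val x.

(* X with the trace of the Borel sigma-algebra of R^d. *)
Definition input : measurableType (preimage_display input_val) :=
  g_sigma_algebra_preimageType input_val.

Definition coords (x : input) : 'rV[R]_d := input_val x.

End input_space.

(* The labels 1, ..., K are numbered 0, ..., K - 1; every set of labels is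
   measurable. *)
Definition label (K : nat) & (0 < K)%N : Type := 'I_K.

Section label_instances.
Context (K : nat) (K0 : (0 < K)%N).

HB.instance Definition _ := Finite.on (label K0).
HB.instance Definition _ := isPointed.Build (label K0) (Ordinal K0).
HB.instance Definition _ := @isMeasurable.Build default_measure_display
  (label K0) discrete_measurable discrete_measurable0
  discrete_measurableC discrete_measurableU.

End label_instances.

Definition tv_dist (dY : measure_display) (Y : measurableType dY)
    (R : realType) (rho rho' : probability Y R) : \bar R :=
  ereal_sup [set `|rho Z - rho' Z|%E | Z in measurable].

Section robustness.
Context (R : realType) (d K : nat) (X : set 'rV[R]_d) (X0 : X !=set0)
  (K0 : (0 < K)%N).

Definition robust (dist : probability (label K0) R ->
      probability (label K0) R -> \bar R)
    (p : \bar R) (alpha eps : R)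
    (m : input X0 -> probability (label K0) R) : Prop :=
  forall x x' : input X0, lpnorm p (coords x - coords x') <= alpha ->
    (dist (m x) (m x') <= eps%:E)%E.

Definition loss01 (rho : probability (label K0) R) (y : label K0) : \bar R :=
  'E_rho[fun yhat => (yhat != y)%:R].

Definition risk (D : probability (input X0 * label K0)%type R)
    (m : input X0 -> probability (label K0) R) : \bar R :=
  (\int[D]_z loss01 (m z.1) z.2)%E.

Definition adv_loss (p : \bar R) (alpha : R)
    (m : input X0 -> probability (label K0) R)
    (z : input X0 * label K0) : \bar R :=
  ereal_sup [set loss01 (m x') z.2 | x' in [set x' : input X0 |
    exists2 tau : 'rV[R]_d, lpnorm p tau <= alpha
                            & coords x' = coords z.1 + tau]].

Definition adv_risk (D : probability (input X0 * label K0)%type R)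
    (p : \bar R) (alpha : R)
    (m : input X0 -> probability (label K0) R) : \bar R :=
  (\int[D]_z adv_loss p alpha m z)%E.

End robustness.

(* Main.v *)
Require Import Defs.
From HB Require Import structures.
From mathcomp Require Import all_boot all_order all_algebra.
From mathcomp Require Import all_classical all_reals all_analysis.
From mathcomp Require Import measurable_realfun.

Import Order.TTheory GRing.Theory Num.Theory.
Import numFieldNormedType.Exports.

Local Open Scope classical_set_scope.
Local Open Scope ring_scope.

(** The 0/1 loss at [(x, y)] is the mass that [m x] gives to the single event [[set~ y]]
    ([loss01E]), and two measures within [eps] in total variation differ by at most [eps] on any
    event ([le_tv_dist]). Robustness thus bounds the loss at every admissible perturbed point by the
    loss at [x] plus [eps]. The supremum obeys the same bound, and integrating against the
    probability [D] gives the claim. [measurable_loss01] justifies the integration. *)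

(** Makes the zero perturbation admissible. For finite [p], the bound [1 <= p] excludes the exponent
    0, where the power of 0 would be 1. *)
Lemma lpnorm0 (R : realType) (d : nat) (p : \bar R) :
  (1 <= p)%E -> lpnorm p (0 : 'rV[R]_d) = 0.
Proof.
move=> p1; rewrite /lpnorm; case: p p1 => [r|_|_]; last first.
- by apply: bigmax_eq_id => i _; rewrite mxE normr0.
- by apply: bigmax_eq_id => i _; rewrite mxE normr0.
rewrite lee_fin => r1; have r0 : r != 0 by rewrite gt_eqF// (lt_le_trans ltr01).
rewrite big1 => [|i _]; first by rewrite powR0// invr_eq0.
by rewrite mxE normr0 powR0.
Qed.

Lemma loss01E (R : realType) (K : nat) (K0 : (0 < K)%N)
    (rho : probability (label K0) R) (y : label K0) :
  loss01 rho y = rho [set~ y].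
Proof.
rewrite /loss01 unlock -[in RHS](setIT [set~ y]) -integral_indic//.
apply: eq_integral => yhat _; rewrite indicE; congr ((nat_of_bool _)%:R%:E).
by apply/idP/idP => [/eqP ?|/set_mem/eqP//]; exact/mem_set.
Qed.

Lemma le_tv_dist (dY : measure_display) (Y : measurableType dY) (R : realType)
    (rho rho' : probability Y R) (eps : R) (Z : set Y) :
  measurable Z -> (tv_dist rho rho' <= eps%:E)%E ->
  (rho Z <= rho' Z + eps%:E)%E.
Proof.
move=> mZ tv_eps.
have Zeps : (`|rho Z - rho' Z| <= eps%:E)%E.
  by apply: le_trans tv_eps; apply: ereal_sup_ubound; exists Z.
have finZ := fin_num_measure rho' _ mZ.
rewrite addeC -leeBlDr//; exact: le_trans (lee_abs _) Zeps.
Qed.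

(** The label factor is finite and discrete, so a preimage is a finite union of measurable
    rectangles, one per label. *)
Lemma measurable_fun_prod_label (dT dU : measure_display)
    (T : measurableType dT) (U : measurableType dU) (K : nat)
    (K0 : (0 < K)%N) (f : T * label K0 -> U) :
  (forall y, measurable_fun setT (fun x => f (x, y))) ->
  measurable_fun setT f.
Proof.
move=> mf _ B mB; rewrite setTI.
have -> : f @^-1` B =
    \bigcup_(y : label K0) (((fun x => f (x, y)) @^-1` B) `*` [set y]).
  apply/seteqP; split => [[x y] fB|[x y] [y' _ [/= fB ->]]//].
  by exists y.
apply: fin_bigcup_measurable => [|y _]; first exact: finite_finset.
apply: measurableX => //; rewrite -[X in measurable X]setTI; exact: mf.
Qed.

(** A measurable map into [pprobability] is a kernel, so its value on the fixed event [[set~ y]] is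
    measurable in the point. *)
Lemma measurable_loss01 (dT : measure_display) (T : measurableType dT)
    (R : realType) (K : nat) (K0 : (0 < K)%N)
    (m : T -> probability (label K0) R) :
  measurable_fun setT (m : T -> pprobability (label K0) R) ->
  measurable_fun setT (fun z : T * label K0 => loss01 (m z.1) z.2).
Proof.
move=> mm; apply: measurable_fun_prod_label => y /=.
under eq_fun do rewrite loss01E.
exact: (measurable_kernel (kprobability mm) [set~ y]).
Qed.

Theorem theorem1 (R : realType) (d K : nat) (X : set 'rV[R]_d)
  (XI : forall x, X x -> forall i, -1 <= x 0 i <= 1)
  (X0 : X !=set0) (K0 : (0 < K)%N)
  (D : probability (input X0 * label K0)%type R)
  (p : \bar R) (p_ge1 : (1 <= p)%E)
  (alpha : R) (alpha_gt0 : 0 < alpha) (eps : R) (eps_ge0 : 0 <= eps)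
  (m : input X0 -> probability (label K0) R)
  (m_meas : measurable_fun setT (m : input X0 -> pprobability (label K0) R))
  (adv_meas : measurable_fun setT (adv_loss p alpha m))
  (m_robust : robust (@tv_dist _ (label K0) R) p alpha eps m) :
  (adv_risk D p alpha m <= risk D m + eps%:E)%E.
Proof.
have loss_ge0 z : (0 <= loss01 (m z.1) z.2)%E by rewrite loss01E.
have m_loss := measurable_loss01 _ _ _ _ _ _ m_meas.
(* Since [D] has total mass 1, [eps] can be moved under the integral, which leaves a pointwise
   comparison of integrands. *)
have -> : (risk D m + eps%:E = \int[D]_z (loss01 (m z.1) z.2 + eps%:E))%E.
  rewrite ge0_integralD//; congr (_ + _)%E.
  by rewrite integral_cst// [X in (_ * X)%E](probability_setT D) mule1.
apply: ge0_le_integral => //.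
- (* [tau = 0] is allowed, so the supremum is not over the empty set. *)
  move=> z _; apply: le_trans (loss_ge0 z) _.
  apply: ereal_sup_ubound; exists z.1 => //.
  by exists 0; rewrite ?addr0// lpnorm0// ltW.
- exact: emeasurable_funD.
(* Each member of the supremum is compared with the loss at [z.1] through the event [[set~ z.2]];
   the displacement from [z.1] to [x'] is exactly [tau]. *)
- move=> z _; apply: ge_ereal_sup => _ [x' [tau tau_alpha x'E] <-].
  rewrite !loss01E; apply: le_tv_dist => //; apply: m_robust.
  by rewrite x'E addrC addKr.
Qed.
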